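(* For every $n\ge2$ and every nonzero vector $\mathbf{v}\in\mathbb{R}^n$, there is a line in $\mathbb{R}^n$ parallel to $\mathbf{v}$ that contains no computably random point.
   Context: In $\mathbb{R}^n$: for $r\in\mathbb{N}$, $\mathbf{u}\in\mathbb{Z}^n$, $Q_r(\mathbf{u})=\prod_{i=1}^n[u_i2^{-r},(u_i+1)2^{-r})$; $\mathcal{Q}_r=\{Q_r(\mathbf{u}):\mathbf{u}\in\{0,\dots,2^r-1\}^n\}$, $\mathcal{Q}=\bigcup_r\mathcal{Q}_r$. A martingale is $d:\mathcal{Q}\to[0,\infty)$ with $d(Q_r(\mathbf{u}))=2^{-n}\sum_{\mathbf{a}\in\{0,1\}^n}d(Q_{r+1}(2\mathbf{u}+\mathbf{a}))$. For $\mathbf{x}\in[0,1)^n$, $d^{(r)}(\mathbf{x})=d(Q)$ for the $Q\in\mathcal{Q}_r$ containing $\mathbf{x}$; $d$ succeeds at $\mathbf{x}$ if $\limsup_rd^{(r)}(\mathbf{x})=\infty$. With $J=\{(r,\mathbf{u}):\mathbf{u}\in\{0,\dots,2^r-1\}^n\}$, $d$ is computable if there is a computable $\widehat d:\mathbb{N}\times J\to\mathbb{Q}\cap[0,\infty)$ with $|\widehat d(s,r,\mathbf{u})-d(Q_r(\mathbf{u}))|\le2^{-s}$ for all $(s,r,\mathbf{u})$. For $E\subseteq\mathbb{R}^n$, $E^\#=[0,1)^n\cap\bigcup_{\mathbf{t}\in\mathbb{Z}^n}(E+\mathbf{t})$; $E$ has computable measure $0$ if some computable martingale succeeds at every point of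 $E^\#$. A point $\mathbf{x}\in\mathbb{R}^n$ is computably random if it belongs to no set of computable measure $0$. *)

(* Defs.v *)
From HB Require Import structures.
From mathcomp Require Import all_boot all_order all_algebra.
From mathcomp Require Import all_classical all_reals all_analysis.

Set Implicit Arguments.
Unset Strict Implicit.
Unset Printing Implicit Defensive.

Import Order.TTheory GRing.Theory Num.Theory.
Import numFieldNormedType.Exports.

Local Open Scope classical_set_scope.
Local Open Scope ring_scope.

(* Kleene's partial recursive functions, as programs [recfun k] of arity [k]
   with an evaluation relation: [rec_eval e v y] holds iff [e] halts on the
   input [v] with output [y]. *)
Inductive recfun : nat -> Type :=
| RZero k : recfun k
| RSucc : recfun 1
| RProj k (i : 'I_k) : recfun k
| RComp k m (f : recfun m) (g : 'I_m -> recfun k) : recfun k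
| RPrim k (f : recfun k) (g : recfun k.+2) : recfun k.+1
| RMu k (f : recfun k.+1) : recfun k.

Inductive rec_eval : forall k, recfun k -> k.-tuple nat -> nat -> Prop :=
| eval_zero k (v : k.-tuple nat) : rec_eval (RZero k) v 0%N
| eval_succ (v : 1.-tuple nat) : rec_eval RSucc v (tnth v ord0).+1
| eval_proj k (i : 'I_k) (v : k.-tuple nat) : rec_eval (RProj i) v (tnth v i)
| eval_comp k m (f : recfun m) (g : 'I_m -> recfun k)
    (v : k.-tuple nat) (w : m.-tuple nat) (y : nat) :
    (forall i, rec_eval (g i) v (tnth w i)) -> rec_eval f w y ->
    rec_eval (RComp f g) v y
| eval_prim0 k (f : recfun k) (g : recfun k.+2) (v : k.-tuple nat) (y : nat) :
    rec_eval f v y -> rec_eval (RPrim f g) [tuple of 0%N :: v] y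
| eval_primS k (f : recfun k) (g : recfun k.+2) (v : k.-tuple nat)
    (m x y : nat) :
    rec_eval (RPrim f g) [tuple of m :: v] x ->
    rec_eval g [tuple of [:: m, x & v]] y ->
    rec_eval (RPrim f g) [tuple of m.+1 :: v] y
| eval_mu k (f : recfun k.+1) (v : k.-tuple nat) (y : nat) :
    rec_eval f [tuple of y :: v] 0%N ->
    (forall m, (m < y)%N -> exists z, rec_eval f [tuple of m :: v] z.+1) ->
    rec_eval (RMu f) v y.

Definition dyadic_cube {R : realType} {n : nat} (r : nat) (u : 'rV[int]_n) :
    set 'rV[R]_n :=
  [set x | forall i, (u 0 i)%:~R * 2 ^- r <= x 0 i < (u 0 i + 1)%:~R * 2 ^- r].

Definition cube_index {n : nat} (r : nat) : set 'rV[int]_n :=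
  [set u | forall i, 0 <= u 0 i < 2 ^+ r].

Definition dyadic_cubes {R : realType} {n : nat} (r : nat) :
    set (set 'rV[R]_n) :=
  [set dyadic_cube r u | u in cube_index r].

Definition subcube_index {n : nat} (u : 'rV[int]_n) (a : 'rV[bool]_n) :
    'rV[int]_n :=
  \row_i (2 * u 0 i + (a 0 i : nat)%:Z).

(* The domain of [d] is the family of all cubes in [dyadic_cubes r], r : nat;
   the values of [d] on other sets are never used. *)
Definition martingale {R : realType} {n : nat} (d : set 'rV[R]_n -> R) : Prop :=
  (forall r Q, dyadic_cubes r Q -> 0 <= d Q) /\
  (forall r u, cube_index r u ->
    d (dyadic_cube r u) =
    2 ^- n * \sum_(a : 'rV[bool]_n) d (dyadic_cube r.+1 (subcube_index u a))).

(* For [x] in the unit cube, exactly one cube satisfies the description. *)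
Definition martingale_at {R : realType} {n : nat} (d : set 'rV[R]_n -> R)
    (r : nat) (x : 'rV[R]_n) : R :=
  d (get [set Q : set 'rV[R]_n | dyadic_cubes r Q /\ Q x]).

Definition succeeds {R : realType} {n : nat} (d : set 'rV[R]_n -> R)
    (x : 'rV[R]_n) : Prop :=
  limn_esup (fun r => (martingale_at d r x)%:E) = +oo%E.

(* On [cube_index r] the entries of [u] are nonnegative, so that taking
   absolute values loses nothing. *)
Definition encode_input {n : nat} (s r : nat) (u : 'rV[int]_n) :
    n.+2.-tuple nat :=
  [tuple of [:: s, r & [tuple `|u 0%R i|%N | i < n]]].

(* A function into the nonnegative rationals is computable when it is the
   quotient of two natural-valued computable functions, the denominator being
   nonzero. *)
Definition computable_ratfun {n : nat} (f : nat -> nat -> 'rV[int]_n -> rat) :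
    Prop :=
  exists num den : recfun n.+2,
    forall s r u, cube_index r u ->
      exists a b : nat,
        [/\ rec_eval num (encode_input s r u) a,
            rec_eval den (encode_input s r u) b,
            b != 0%N
          & f s r u = a%:R / b%:R].

Definition computable_martingale {R : realType} {n : nat}
    (d : set 'rV[R]_n -> R) : Prop :=
  martingale d /\
  exists dhat : nat -> nat -> 'rV[int]_n -> rat,
    computable_ratfun dhat /\
    (forall s r u, cube_index r u ->
      0 <= dhat s r u /\
      `|ratr (dhat s r u) - d (dyadic_cube r u)| <= 2 ^- s).

Definition unit_cube {R : realType} {n : nat} : set 'rV[R]_n :=
  [set x | forall i, 0 <= x 0 i < 1].

Definition periodized {R : realType} {n : nat} (E : set 'rV[R]_n) :
    set 'rV[R]_n :=
  unit_cube `&`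
  \bigcup_(t in [set: 'rV[int]_n]) [set x + map_mx intr t | x in E].

Definition computable_measure0 {R : realType} {n : nat} (E : set 'rV[R]_n) :
    Prop :=
  exists d : set 'rV[R]_n -> R,
    computable_martingale d /\ (forall x, periodized E x -> succeeds d x).

Definition computably_random {R : realType} {n : nat} (x : 'rV[R]_n) : Prop :=
  ~ exists E : set 'rV[R]_n, computable_measure0 E /\ E x.

Definition line {R : realType} {n : nat} (p v : 'rV[R]_n) : set 'rV[R]_n :=
  [set p + t *: v | t in [set: R]].

(* Main.v *)
Require Import Defs.
From HB Require Import structures.
From mathcomp Require Import all_boot all_order all_algebra.
From mathcomp Require Import all_classical all_reals all_analysis.
From mathcomp Require Import zify ring lra.
Import Order.TTheory GRing.Theory Num.Theory.
Local Open Scope classical_set_scope.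
Local Open Scope ring_scope.

Set Implicit Arguments.
Unset Strict Implicit.
Unset Printing Implicit Defensive.

(* Write the slope of the line as m = q + mu with q an integer and 0 <= mu < 1,
   let mu_l be mu truncated to its first l^2 bits, and put c = - sum_l (mu_(l+1) -
   mu_l) xi_l, where the nodes xi_l run through finer and finer nets of larger
   and larger intervals.  Then
     m x + c = q x + sum_l (mu_(l+1) - mu_l) (x - xi_l),
   so that, when |x - xi_k| <= 2^-s, the number m x + c is determined up to
   O(2^-(k^2 + s)) by the first k^2 bits of mu.  Hence the point (x, m x + c) lies
   in a set made of 2^(k^2) strips and of area O(2^-s), computable from the
   integer parts of m and x alone, and this happens for every large s.  A
   martingale that adds up the relative areas of these sets (counted with
   multiplicity) succeeds at the point.  Each point of the line has its own
   martingale, which may depend on q and on the integer part of x. *)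

(** * Closure properties of the recursive functions *)

(** Plain sequences replace tuples so that arguments can be shifted and inserted without dependent
    types; only sequences of length [k] matter. *)
Definition computes (k : nat) (f : seq nat -> nat) : Prop :=
  exists e : recfun k, forall v : k.-tuple nat, rec_eval e v (f v).

Lemma eq_computes k f g :
  (forall v : seq nat, size v = k -> f v = g v) -> computes k f -> computes k g.
Proof.
move=> fg [e ev]; exists e => v.
by rewrite -fg ?size_tuple.
Qed.

Lemma computes_comp k m (f : seq nat -> nat) (g : nat -> seq nat -> nat) :
  computes m f -> (forall i, (i < m)%N -> computes k (g i)) ->
  computes k (fun v => f (mkseq (g^~ v) m)).
Proof.
move=> [ef fP] gP.
have [eg egP] : exists eg : 'I_m -> recfun k,
    forall (i : 'I_m) v, rec_eval (eg i) v (g i v).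
  have gP' (i : 'I_m) : exists e, forall v : k.-tuple nat, rec_eval e v (g i v).
    exact: gP.
  by have [eg egP] := choice gP'; exists eg.
exists (RComp ef eg) => v.
have sz : size (mkseq (g^~ v) m) == m by rewrite size_mkseq.
apply: (@eval_comp _ _ _ _ _ (Tuple sz)); last exact: fP (Tuple sz).
move=> i; rewrite (tnth_nth 0%N) /= nth_mkseq //; exact: egP.
Qed.

Lemma computes_succ k f : computes k f -> computes k (fun v => (f v).+1).
Proof.
move=> fP; apply: (@computes_comp k 1 (fun v => (nth 0 v 0).+1)%N (fun _ => f)) => //.
exists RSucc => v; have := eval_succ v.
by rewrite (tnth_nth 0%N).
Qed.

Lemma computes_const k c : computes k (fun=> c).
Proof.
elim: c => [|c]; first by exists (RZero k) => v; exact: eval_zero.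
exact: computes_succ.
Qed.

(* Out-of-range indices give the constant [0]. *)
Lemma computes_var k i : computes k (fun v => nth 0%N v i).
Proof.
have [ik|ki] := ltnP i k.
  exists (RProj (Ordinal ik)) => v; have := eval_proj (Ordinal ik) v.
  by rewrite (tnth_nth 0%N).
apply: eq_computes (computes_const k 0%N) => v vk.
by rewrite nth_default ?vk.
Qed.

Lemma computes_behead k f : computes k f -> computes k.+1 (fun v => f (behead v)).
Proof.
move=> fP.
have := @computes_comp k.+1 k f (fun i v => nth 0%N v i.+1) fP
  (fun i _ => computes_var _ _).
apply: eq_computes => v vk; congr f.
apply: (@eq_from_nth _ 0%N); first by rewrite size_mkseq size_behead vk.
by move=> i; rewrite size_mkseq => ik; rewrite nth_mkseq// nth_behead.
Qed.

Lemma computes_cons k (b : seq nat -> nat) f :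
  computes k b -> computes k.+1 f -> computes k (fun v => f (b v :: v)).
Proof.
move=> bP fP.
pose g i := if i is j.+1 then fun v => nth 0%N v j else b.
have gP i : (i < k.+1)%N -> computes k (g i).
  by case: i => [|i] _; [exact: bP|exact: computes_var].
apply: eq_computes (computes_comp fP gP) => v vk; congr f.
apply: (@eq_from_nth _ 0%N); first by rewrite size_mkseq /= vk.
by move=> [|i]; rewrite size_mkseq => ik; rewrite nth_mkseq.
Qed.

(** [RPrim] recurses on its first argument, so [computes_cons] puts the counter [b v] in front; the
    step function sees counter, accumulator, then parameters. *)
Lemma computes_iteri k b f (g : nat -> nat -> seq nat -> nat) :
  computes k b -> computes k f ->
  computes k.+2 (fun w => g (nth 0 w 0) (nth 0 w 1) (behead (behead w)))%N ->
  computes k (fun v => iteri (b v) (fun m x => g m x v) (f v)).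
Proof.
move=> bP [ef fP] [eg gP].
apply: (@computes_cons k b
  (fun w => iteri (head 0%N w) (fun m x => g m x (behead w)) (f (behead w)))) => //.
exists (RPrim ef eg) => w.
have -> : w = [tuple of thead w :: behead_tuple w] by rewrite -tuple_eta.
move: (thead w) (behead_tuple w) => m {w} v /=.
elim: m => [|m IHm] /=; first exact: eval_prim0 (fP v).
apply: eval_primS IHm _.
exact: (gP [tuple of [:: m, _ & v]]).
Qed.

Lemma computes_add k f g :
  computes k f -> computes k g -> computes k (fun v => f v + g v)%N.
Proof.
move=> fP gP.
have := computes_iteri (g := fun _ x _ => x.+1) gP fP
  (computes_succ (computes_var _ _)).
apply: eq_computes => v _; elim: (g v) => [|n /= ->]; by rewrite ?addn0 ?addnS.
Qed.

Lemma computes_mul k f g :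
  computes k f -> computes k g -> computes k (fun v => f v * g v)%N.
Proof.
move=> fP gP.
have := computes_iteri (g := fun _ x v => x + f v)%N gP (computes_const k 0)
  (computes_add (computes_var _ _)
     (computes_behead (computes_behead fP))).
apply: eq_computes => v _; elim: (g v) => [|n /= ->]; by rewrite ?muln0 ?mulnSr.
Qed.

Lemma computes_exp k f g :
  computes k f -> computes k g -> computes k (fun v => f v ^ g v)%N.
Proof.
move=> fP gP.
have := computes_iteri (g := fun _ x v => x * f v)%N gP (computes_const k 1)
  (computes_mul (computes_var _ _)
     (computes_behead (computes_behead fP))).
apply: eq_computes => v _; elim: (g v) => [|n /= ->]; by rewrite ?expn0 ?expnSr.
Qed.

Lemma computes_pred k f : computes k f -> computes k (fun v => (f v).-1).
Proof.
move=> fP.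
have := computes_iteri (g := fun m _ _ => m) fP (computes_const k 0)
  (computes_var _ _).
by apply: eq_computes => v _; case: (f v).
Qed.

Lemma computes_sub k f g :
  computes k f -> computes k g -> computes k (fun v => f v - g v)%N.
Proof.
move=> fP gP.
have := computes_iteri (g := fun _ x _ => x.-1) gP fP
  (computes_pred (computes_var _ _)).
apply: eq_computes => v _; elim: (g v) => [|n /= ->]; by rewrite ?subn0 ?subnS.
Qed.

Lemma computes_leq k f g :
  computes k f -> computes k g -> computes k (fun v => (f v <= g v)%N : nat).
Proof.
move=> fP gP.
have := computes_sub (computes_const k 1) (computes_sub fP gP).
by apply: eq_computes => v _; rewrite -subn_eq0; case: (f v - g v)%N.
Qed.

Lemma computes_sum k b (F : nat -> seq nat -> nat) :
  computes k b -> computes k.+1 (fun w => F (nth 0 w 0)%N (behead w)) ->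
  computes k (fun v => \sum_(i < b v) F i v)%N.
Proof.
move=> bP FP.
have FP2 : computes k.+2
    (fun w => nth 0 w 1 + F (nth 0 w 0) (behead (behead w)))%N.
  apply: computes_add; first exact: computes_var.
  (* The accumulator in position [1] is skipped: [F] sees the counter and the parameters. *)
  pose g i w := nth 0%N w (if i is j.+1 then j.+2 else 0%N).
  have gP i : (i < k.+1)%N -> computes k.+2 (g i) by move=> _; exact: computes_var.
  apply: eq_computes (computes_comp FP gP) => w wk; congr F.
  apply: (@eq_from_nth _ 0%N) => [|i].
    by rewrite !size_behead size_mkseq wk.
  rewrite size_behead size_mkseq => ik.
  by rewrite !nth_behead nth_mkseq.
have := computes_iteri (g := fun m x v => x + F m v)%N bP (computes_const k 0) FP2.
apply: eq_computes => v _.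
elim: (b v) => [|n /= ->]; by rewrite ?big_ord0 ?big_ord_recr.
Qed.

Lemma sum_ltn_ord n q : (\sum_(i < n) (i < q) = minn n q)%N.
Proof.
elim: n => [|n IHn]; first by rewrite big_ord0 min0n.
by rewrite big_ord_recr /= IHn; case: ltnP; lia.
Qed.

(** The quotient counts the [i < f v] with [i.+1 * g v <= f v], so a bounded sum suffices. *)
Lemma computes_div k f g : (forall v, 0 < g v)%N ->
  computes k f -> computes k g -> computes k (fun v => f v %/ g v)%N.
Proof.
move=> g_gt0 fP gP.
have := computes_sum (F := fun i v => (i.+1 * g v <= f v)%N : nat) fP
  (computes_leq
     (computes_mul (computes_succ (computes_var _ _))
        (computes_behead gP)) (computes_behead fP)).
apply: eq_computes => v _.
rewrite -[RHS](minn_idPr (leq_div (f v) (g v))) -sum_ltn_ord.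
by apply: eq_bigr => i _; rewrite /= -leq_divRL.
Qed.

Lemma computes_mod k f g : (forall v, 0 < g v)%N ->
  computes k f -> computes k g -> computes k (fun v => f v %% g v)%N.
Proof.
move=> g_gt0 fP gP.
have := computes_sub fP (computes_mul (computes_div g_gt0 fP gP) gP).
by apply: eq_computes => v _; rewrite {1}(divn_eq (f v) (g v)) addKn.
Qed.

Lemma computes_app1 k (f : nat -> nat) a :
  computes 1 (fun w => f (nth 0 w 0))%N ->
  computes k a -> computes k (fun v => f (a v)).
Proof.
move=> fP aP.
by have := @computes_comp k 1 _ (fun=> a) fP; apply.
Qed.

Lemma computes_app2 k (f : nat -> nat -> nat) a b :
  computes 2 (fun w => f (nth 0 w 0) (nth 0 w 1))%N ->
  computes k a -> computes k b -> computes k (fun v => f (a v) (b v)).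
Proof.
move=> fP aP bP.
have := @computes_comp k 2 _ (nth a [:: a; b]) fP; apply.
by case=> [|[]].
Qed.

Lemma computes_app3 k (f : nat -> nat -> nat -> nat) a b c :
  computes 3 (fun w => f (nth 0 w 0) (nth 0 w 1) (nth 0 w 2))%N ->
  computes k a -> computes k b -> computes k c ->
  computes k (fun v => f (a v) (b v) (c v)).
Proof.
move=> fP aP bP cP.
have := @computes_comp k 3 _ (nth a [:: a; b; c]) fP; apply.
by case=> [|[|[]]].
Qed.

Definition nsum (n : nat) (F : nat -> nat) : nat := (\sum_(i < n) F i)%N.

Lemma computes_nsum k b (F : seq nat -> nat -> nat) :
  computes k b -> computes k.+1 (fun w => F (behead w) (nth 0 w 0))%N ->
  computes k (fun v => nsum (b v) (F v)).
Proof. exact: (computes_sum (F := fun i v => F v i)). Qed.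

Ltac computes_step :=
  lazymatch goal with
  | |- computes _ (fun=> ?c) => exact: computes_const
  | |- computes _ (fun v => nth 0%N v _) => exact: computes_var
  | |- computes _ (fun v => nth 0%N (behead v) ?i) =>
      exact: (computes_behead (computes_var _ i))
  | |- computes _ (fun v => nth 0%N (behead (behead v)) ?i) =>
      exact: (computes_behead (computes_behead (computes_var _ i)))
  | |- computes _ (fun v => (@?a v).+1) => apply: (@computes_succ _ a)
  | |- computes _ (fun v => addn (@?a v) (@?b v)) => apply: (@computes_add _ a b)
  | |- computes _ (fun v => subn (@?a v) (@?b v)) => apply: (@computes_sub _ a b)
  | |- computes _ (fun v => muln (@?a v) (@?b v)) => apply: (@computes_mul _ a b)
  | |- computes _ (fun v => expn (@?a v) (@?b v)) => apply: (@computes_exp _ a b)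
  | |- computes _ (fun v => divn (@?a v) (@?b v)) =>
      apply: (@computes_div _ a b); [by move=> ?; rewrite expn_gt0| |]
  | |- computes _ (fun v => modn (@?a v) (@?b v)) =>
      apply: (@computes_mod _ a b); [by move=> ?; rewrite expn_gt0| |]
  | |- computes _ (fun v => nat_of_bool (leq (@?a v) (@?b v))) =>
      apply: (@computes_leq _ a b)
  | |- computes _ (fun v => nsum (@?b v) (@?F v)) =>
      apply: (@computes_nsum _ b F)
  | |- computes _ (fun v => ?f (@?a v) (@?b v) (@?c v)) =>
      apply: (@computes_app3 _ f a b c)
  | |- computes _ (fun v => ?f (@?a v) (@?b v)) => apply: (@computes_app2 _ f a b)
  | |- computes _ (fun v => ?f (@?a v)) => apply: (@computes_app1 _ f a)
  end.

Ltac computes_auto := repeat first [assumption | computes_step; cbv beta].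

(** * From summable tests to martingales *)

(* For [f] defined on the dyadic intervals of level [m], [refine_sum m r x f] is
   [2 ^ m] times the average of [f] over the interval of index [x] and level [r];
   intervals of level [r >= m] inherit the value of their ancestor. *)
Definition refine_sum (m r x : nat) (f : nat -> nat) : nat :=
  \sum_(i < 2 ^ m) f ((x * 2 ^ m + i) %/ 2 ^ r)%N.

Lemma sum_ord_double n (F : nat -> nat) :
  (\sum_(i < n.*2) F i = \sum_(i < n) (F i.*2 + F i.*2.+1))%N.
Proof.
elim: n => [|n IHn]; first by rewrite !big_ord0.
by rewrite doubleS !big_ord_recr /= IHn addnA.
Qed.

(** One-dimensional averaging identity: the two halves run through [2 * 2 ^ m] consecutive
    numerators, and each even-odd pair has a single quotient by [2 ^ r.+1]. *)
Lemma refine_sum_split m r x f :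
  (refine_sum m r.+1 x.*2 f + refine_sum m r.+1 x.*2.+1 f =
   2 * refine_sum m r x f)%N.
Proof.
transitivity (\sum_(i < (2 ^ m).*2) f (((x * 2 ^ m).*2 + i) %/ 2 ^ r.+1))%N.
  rewrite -[((2 ^ m).*2)%N]addnn big_split_ord /=.
  by congr addn; apply: eq_bigr => i _; congr (f (_ %/ _)%N); lia.
rewrite (sum_ord_double _ (fun i => f (((x * 2 ^ m).*2 + i) %/ 2 ^ r.+1))%N).
rewrite big_distrr /=; apply: eq_bigr => i _.
have half b : (b < 2)%N ->
    (((x * 2 ^ m + i).*2 + b) %/ 2 ^ r.+1 = (x * 2 ^ m + i) %/ 2 ^ r)%N.
  by move=> b2; rewrite expnS divnMA -muln2 divnMDl// (divn_small b2) addn0.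
have half0 := half 0%N isT; have half1 := half 1%N isT.
rewrite addn0 doubleD in half0; rewrite addn1 doubleD in half1.
by rewrite addnS half0 half1 mul2n addnn.
Qed.

Lemma refine_sum_coarse m r x f : (m <= r)%N ->
  refine_sum m r x f = (2 ^ m * f (x %/ 2 ^ (r - m)))%N.
Proof.
move=> mr; rewrite /refine_sum (eq_bigr (fun=> f (x %/ 2 ^ (r - m))%N)).
  by rewrite sum_nat_const card_ord.
move=> i _; congr f; rewrite -{1}(subnKC mr) expnD divnMA.
by rewrite divnMDl ?expn_gt0// (divn_small (ltn_ord i)) addn0.
Qed.

(** Descending from the root, one child has at most the sum of both children, which is twice the
    value of the parent. *)
Lemma refine_sum_le m r x f : (x < 2 ^ r)%N ->
  (refine_sum m r x f <= 2 ^ r * \sum_(i < 2 ^ m) f i)%N.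
Proof.
elim: r x => [|r IHr] x xr.
  move: xr; rewrite expn0 ltnS leqn0 => /eqP ->.
  by rewrite mul1n; apply: leq_sum => i _; rewrite mul0n add0n divn1.
have x2r : (x./2 < 2 ^ r)%N by rewrite ltn_half_double -mul2n -expnS.
apply: (@leq_trans (2 * refine_sum m r x./2 f)); last first.
  by rewrite expnS -mulnA leq_mul2l IHr.
rewrite -refine_sum_split.
have := odd_double_half x; case: (odd x) => /= xE; rewrite -[in leqLHS]xE.
- by rewrite add1n leq_addl.
- by rewrite add0n leq_addr.
Qed.

(** This is [4 ^ m] times the average of [T] over the dyadic square of index [(x, y)] and level
    [r]. *)
Definition test_mass (m : nat) (T : nat -> nat -> nat) (r x y : nat) : nat :=
  refine_sum m r x (fun a => refine_sum m r y (T a)).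

Lemma test_mass_split m T r x y :
  (\sum_(b : bool) \sum_(c : bool)
     test_mass m T r.+1 (x.*2 + b) (y.*2 + c) = 4 * test_mass m T r x y)%N.
Proof.
rewrite !big_bool /= !addn0 !addn1 /test_mass.
have E a : (refine_sum m r.+1 a (fun a => refine_sum m r.+1 y.*2.+1 (T a)) +
   refine_sum m r.+1 a (fun a => refine_sum m r.+1 y.*2 (T a)) =
   2 * refine_sum m r.+1 a (fun a => refine_sum m r y (T a)))%N.
  rewrite /refine_sum -big_split big_distrr /=; apply: eq_bigr => i _.
  by rewrite addnC refine_sum_split.
rewrite !E -mulnDr addnC refine_sum_split; lia.
Qed.

Lemma test_mass_coarse m T r x y : (m <= r)%N ->
  test_mass m T r x y =
  (4 ^ m * T (x %/ 2 ^ (r - m)) (y %/ 2 ^ (r - m)))%N.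
Proof.
move=> mr; rewrite /test_mass refine_sum_coarse// refine_sum_coarse//.
by rewrite mulnA -expnMn.
Qed.

Lemma test_mass_le m T r x y : (x < 2 ^ r)%N -> (y < 2 ^ r)%N ->
  (test_mass m T r x y <=
   4 ^ r * \sum_(i < 2 ^ m) \sum_(j < 2 ^ m) T i j)%N.
Proof.
move=> xr yr; apply: leq_trans (refine_sum_le _ _ xr) _.
rewrite -[4%N]/(2 * 2)%N expnMn -mulnA leq_pmul2l ?expn_gt0// big_distrr /=.
by apply: leq_sum => i _; exact: refine_sum_le.
Qed.

(* Averaging over the flips of the bits [i0] and [i1]. *)
Lemma sum_row_bool2 (R : realType) n (i0 i1 : 'I_n) (F : bool -> bool -> R) :
  i0 != i1 ->
  4 * \sum_(a : 'rV[bool]_n) F (a 0 i0) (a 0 i1) =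
  2 ^+ n * \sum_(b : bool) \sum_(c : bool) F b c.
Proof.
move=> i01.
pose flip (i : 'I_n) (a : 'rV[bool]_n) : 'rV[bool]_n :=
  \row_j ((j == i) (+) a 0 j).
have flipK i : involutive (flip i).
  by move=> a; apply/rowP => j; rewrite !mxE addbA addbb.
have flipE i (G : 'rV[bool]_n -> R) : \sum_a G a = \sum_a G (flip i a).
  by rewrite (reindex_inj (inv_inj (flipK i))).
pose S := \sum_(a : 'rV[bool]_n) F (a 0 i0) (a 0 i1).
have S0 : S = \sum_(a : 'rV[bool]_n) F (~~ a 0 i0) (a 0 i1).
  rewrite /S (flipE i0); apply: eq_bigr => a _.
  by rewrite !mxE eqxx eq_sym (negbTE i01).
have S1 : S = \sum_(a : 'rV[bool]_n) F (a 0 i0) (~~ a 0 i1).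
  rewrite /S (flipE i1); apply: eq_bigr => a _.
  by rewrite !mxE eqxx (negbTE i01).
have S01 : S = \sum_(a : 'rV[bool]_n) F (~~ a 0 i0) (~~ a 0 i1).
  rewrite S0 (flipE i1); apply: eq_bigr => a _.
  by rewrite !mxE eqxx (negbTE i01).
transitivity (S + \sum_(a : 'rV[bool]_n) F (~~ a 0 i0) (a 0 i1) +
    \sum_(a : 'rV[bool]_n) F (a 0 i0) (~~ a 0 i1) +
    \sum_(a : 'rV[bool]_n) F (~~ a 0 i0) (~~ a 0 i1)).
  by rewrite -S0 -S1 -S01 -/S; ring.
rewrite /S -!big_split /=.
rewrite (eq_bigr (fun=> \sum_(b : bool) \sum_(c : bool) F b c)) => [|a _].
  by rewrite sumr_const card_mx card_bool mul1n -[LHS]mulr_natl natrX.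
by rewrite !big_bool /=; case: (a 0 i0); case: (a 0 i1) => /=; ring.
Qed.

(** * Infinite sums of tests *)

Lemma sup_between (R : realType) (a b : nat -> R) :
  (forall i j, a i <= b j) -> forall i, a i <= sup (range a) <= b i.
Proof.
move=> ab i.
have hs : has_sup (range a).
  by split; [exists (a 0%N), 0%N|exists (b 0%N) => _ [j _ <-]].
apply/andP; split; first by apply: sup_upper_bound => //; exists i.
by apply: ge_sup; [exists (a 0%N), 0%N|move=> _ [j _ <-]].
Qed.

Lemma eq_by_pow2 (R : realType) (a b C : R) :
  (forall K : nat, `|a - b| <= C / 2 ^+ K) -> a = b.
Proof.
move=> abC; apply/eqP; rewrite -subr_eq0 -normr_eq0.
have : 0 <= `|a - b| by [].
rewrite le0r => /orP[//|ab0].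
have := abC (Num.bound (C / `|a - b|)).
rewrite ler_pdivlMr ?exprn_gt0// -ler_pdivlMl// mulrC leNgt.
by rewrite upper_nthrootP.
Qed.

(** Each summand is the average of [T k] over the square, so every partial sum obeys the averaging
    identity. *)
Definition mass_series (R : realType) (N : nat -> nat)
    (T : nat -> nat -> nat -> nat) (K r x y : nat) : R :=
  \sum_(k < K) (test_mass (N k) (T k) r x y)%:R / 4 ^+ N k.

(** The partial sums increase with [K], so for light tests this supremum is the sum of the infinite
    series. *)
Definition test_martingale (R : realType) (N : nat -> nat)
    (T : nat -> nat -> nat -> nat) (r x y : nat) : R :=
  sup (range (fun K => mass_series R N T K r x y)).

(* The test [T k] is a function on the dyadic squares of level [N k], a set of
   squares counted with multiplicity; lightness bounds its area by [w / 2 ^ k]. *)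
Definition light (N : nat -> nat) (T : nat -> nat -> nat -> nat) (w : nat) :=
  forall k, (2 ^ k * \sum_(i < 2 ^ N k) \sum_(j < 2 ^ N k) T k i j <=
             w * 4 ^ N k)%N.

(** Even if the whole area [w / 2 ^ k] of the test lies in one square of area [4 ^- r], the average
    there is only [4 ^ r] times larger. *)
Lemma mass_term_le (R : realType) N T w k r x y : light N T w ->
  (x < 2 ^ r)%N -> (y < 2 ^ r)%N ->
  (test_mass (N k) (T k) r x y)%:R / 4 ^+ N k <= 4 ^+ r * w%:R / 2 ^+ k :> R.
Proof.
move=> Tw xr yr.
rewrite ler_pdivrMr ?exprn_gt0// mulrAC ler_pdivlMr ?exprn_gt0//.
rewrite -!natrX -!natrM ler_nat.
apply: (@leq_trans (4 ^ r * (2 ^ k *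
    \sum_(i < 2 ^ N k) \sum_(j < 2 ^ N k) T k i j))%N); last first.
  by rewrite -mulnA leq_pmul2l ?expn_gt0//; exact: Tw.
by rewrite mulnC mulnCA leq_pmul2l ?expn_gt0//; exact: test_mass_le.
Qed.

Lemma mass_series_ge (R : realType) N T K j r x y :
  mass_series R N T K r x y <= mass_series R N T (K + j) r x y.
Proof.
elim: j => [|j IHj]; first by rewrite addn0.
rewrite addnS {2}/mass_series big_ord_recr /=.
by rewrite (le_trans IHj)// lerDl divr_ge0.
Qed.

Lemma mass_series_tail (R : realType) N T w K j r x y : light N T w ->
  (x < 2 ^ r)%N -> (y < 2 ^ r)%N ->
  mass_series R N T (K + j) r x y <=
  mass_series R N T K r x y + 2 * (4 ^+ r * w%:R) / 2 ^+ K.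
Proof.
move=> Tw xr yr.
set C := 4 ^+ r * w%:R.
(* The subtracted term closes the induction: it shrinks by exactly [C / 2 ^+ (K + j)], the bound on
   the next summand. *)
suff : mass_series R N T (K + j) r x y <=
    mass_series R N T K r x y + 2 * C / 2 ^+ K - 2 * C / 2 ^+ (K + j).
  by move/le_trans; apply; rewrite lerBlDr lerDl divr_ge0// !mulr_ge0.
elim: j => [|j IHj]; first by rewrite addn0 addrK.
rewrite addnS {1}/mass_series big_ord_recr /= -/(mass_series _ _ _ _ _ _ _).
have := mass_term_le R (K + j) Tw xr yr; rewrite -/C.
have -> : 2 * C / 2 ^+ (K + j).+1 = C / 2 ^+ (K + j).
  by rewrite exprS invfM; field; rewrite ?expf_neq0.
move: IHj; rewrite -[2 * C / _]mulrA; lra.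
Qed.

(** The geometric tail gives an explicit rate of convergence, from which both the averaging identity
    and computability follow. *)
Lemma test_martingale_between (R : realType) N T w K r x y : light N T w ->
  (x < 2 ^ r)%N -> (y < 2 ^ r)%N ->
  mass_series R N T K r x y <= test_martingale R N T r x y <=
  mass_series R N T K r x y + 2 * (4 ^+ r * w%:R) / 2 ^+ K.
Proof.
move=> Tw xr yr.
apply: (@sup_between _ (fun K => mass_series R N T K r x y)
  (fun K => mass_series R N T K r x y + 2 * (4 ^+ r * w%:R) / 2 ^+ K)) => i j.
have [ij|/ltnW ji] := leqP i j.
  apply: (@le_trans _ _ (mass_series R N T j r x y)).
    by rewrite -(subnKC ij); exact: mass_series_ge.
  by rewrite lerDl divr_ge0// !mulr_ge0.
by rewrite -(subnKC ji); exact: mass_series_tail.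
Qed.

Lemma test_martingale_split (R : realType) N T w r x y : light N T w ->
  (x < 2 ^ r)%N -> (y < 2 ^ r)%N ->
  \sum_(b : bool) \sum_(c : bool)
     test_martingale R N T r.+1 (x.*2 + b)%N (y.*2 + c)%N =
  4 * test_martingale R N T r x y.
Proof.
(* The identity is exact for partial sums; the constant adds the tail bounds of the four
   children. *)
move=> Tw xr yr; apply: (@eq_by_pow2 _ _ _ (4 * (2 * (4 ^+ r.+1 * w%:R)))) => K.
have SE : \sum_(b : bool) \sum_(c : bool)
    mass_series R N T K r.+1 (x.*2 + b)%N (y.*2 + c)%N =
    4 * mass_series R N T K r x y.
  rewrite /mass_series big_distrr /=.
  under eq_bigr do rewrite exchange_big /=.
  rewrite exchange_big /=; apply: eq_bigr => k _.
  under eq_bigr do rewrite -big_distrl /= -natr_sum.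
  by rewrite -big_distrl /= -natr_sum test_mass_split natrM mulrA.
have lt2 z (b : bool) : (z < 2 ^ r)%N -> (z.*2 + b < 2 ^ r.+1)%N.
  by rewrite expnS; case: b => /=; lia.
have B (b c : bool) := test_martingale_between R K Tw (lt2 _ b xr) (lt2 _ c yr).
have B0 := test_martingale_between R K Tw xr yr.
have E0 : 0 <= 4 ^+ r * w%:R / 2 ^+ K :> R by rewrite divr_ge0 ?mulr_ge0.
move: B0 (B true true) (B true false) (B false true) (B false false) SE.
rewrite !big_bool /= exprS.
rewrite (_ : 2 * (4 * 4 ^+ r * w%:R) / 2 ^+ K =
  8 * (4 ^+ r * w%:R / 2 ^+ K)); last by ring.
rewrite (_ : 4 * (2 * (4 * 4 ^+ r * w%:R)) / 2 ^+ K =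
  32 * (4 ^+ r * w%:R / 2 ^+ K)); last by ring.
rewrite (_ : 2 * (4 ^+ r * w%:R) / 2 ^+ K =
  2 * (4 ^+ r * w%:R / 2 ^+ K)); last by ring.
move: (_ / 2 ^+ K) E0 => e e0.
move=> /andP[? ?] /andP[? ?] /andP[? ?] /andP[? ?] /andP[? ?] ?.
rewrite ler_norml; apply/andP; split; lra.
Qed.

(** * Dyadic cells, dyadic cubes and martingales in two coordinates *)

Definition cell (R : realType) (r : nat) (t : R) : nat := Num.truncn (2 ^+ r * t).

Lemma cell_itv (R : realType) r (t : R) : 0 <= t ->
  (cell r t)%:R <= 2 ^+ r * t < (cell r t).+1%:R.
Proof. by move=> t0; apply: truncn_itv; rewrite mulr_ge0. Qed.

Lemma cell_lt (R : realType) r (t : R) : 0 <= t < 1 -> (cell r t < 2 ^ r)%N.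
Proof.
move=> /andP[t0 t1]; rewrite truncn_lt_nat ?mulr_ge0//.
by rewrite natrX gtr_pMr ?exprn_gt0.
Qed.

Lemma cell_coarse (R : realType) m r (t : R) : 0 <= t -> (m <= r)%N ->
  (cell r t %/ 2 ^ (r - m))%N = cell m t.
Proof.
move=> t0 mr; apply/esym/truncn_def.
have /andP[lo hi] := cell_itv r t0.
rewrite -(@ler_pM2l _ (2 ^+ (r - m))) ?exprn_gt0//.
rewrite -[X in _ && X](@ltr_pM2l _ (2 ^+ (r - m))) ?exprn_gt0//.
rewrite mulrA -exprD subnK//; apply/andP; split.
  by apply: le_trans lo; rewrite -natrX -natrM ler_nat mulnC leq_divM.
apply: lt_le_trans hi _; rewrite -natrX -natrM ler_nat mulnC.
by rewrite ltn_ceil ?expn_gt0.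
Qed.

(** Testing the inclusion at the lower corner of the first cube compares the corners. If [r < s],
    its centre would lie at least [2 ^- s] beyond the lower corner of the second cube in coordinate
    [i], hence outside. *)
Lemma sub_dyadic_cube (R : realType) n (i : 'I_n) r s (u w : 'rV[int]_n) :
  @dyadic_cube R n r u `<=` dyadic_cube s w ->
  (s <= r)%N /\ forall j, (w 0 j)%:~R / 2 ^+ s <= (u 0 j)%:~R / 2 ^+ r :> R.
Proof.
move=> sub.
have pt (l : R) : 0 <= l < 1 ->
    dyadic_cube s w (\row_j (((u 0 j)%:~R + l) / 2 ^+ r)).
  move=> /andP[l0 l1]; apply: sub => j; rewrite mxE.
  rewrite ler_pM2r ?invr_gt0 ?exprn_gt0// ltr_pM2r ?invr_gt0 ?exprn_gt0//.
  by rewrite lerDl l0 intrD ltrD2l.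
have lo j : (w 0 j)%:~R / 2 ^+ s <= (u 0 j)%:~R / 2 ^+ r :> R.
  have l0 : 0 <= (0 : R) < 1 by apply/andP; split; lra.
  by have := pt _ l0 j; rewrite mxE addr0 => /andP[].
split=> //; rewrite leqNgt; apply/negP => rs.
have l2 : 0 <= (2^-1 : R) < 1 by apply/andP; split; lra.
have := pt _ l2 i; rewrite mxE intrD !mulrDl mul1r => /andP[_].
apply/negP; rewrite -leNgt lerD//.
rewrite -invfM lef_pV2 ?posrE ?mulr_gt0 ?exprn_gt0//.
by rewrite -exprS ler_weXn2l// ler1n.
Qed.

Lemma dyadic_cube_inj (R : realType) n (i : 'I_n) r s (u w : 'rV[int]_n) :
  @dyadic_cube R n r u = dyadic_cube s w -> (r, u) = (s, w).
Proof.
move=> /seteqP[/(sub_dyadic_cube i)[sr lo] /(sub_dyadic_cube i)[rs hi]].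
have {sr rs}rs : r = s by apply/eqP; rewrite eqn_leq rs.
congr pair => //; apply/rowP => j; have := lo j; have := hi j.
rewrite rs !ler_pM2r ?invr_gt0 ?exprn_gt0// !ler_int => le1 le2.
by apply/eqP; rewrite eq_le le1.
Qed.

(** Martingales take sets as arguments, so level and index are recovered from the set;
    [dyadic_cube_inj] makes them unique in positive dimension. *)
Definition cube_coords (R : realType) n (Q : set 'rV[R]_n) : nat * 'rV[int]_n :=
  xget (0%N, 0) [set p | cube_index p.1 p.2 /\ dyadic_cube p.1 p.2 = Q].

(** Lifts a function on planar dyadic squares to dimension [n] by betting on two coordinates
    only. *)
Definition planar (R : realType) n (i0 i1 : 'I_n) (D : nat -> nat -> nat -> R)
    (Q : set 'rV[R]_n) : R :=
  D (cube_coords Q).1 `|(cube_coords Q).2 0%R i0|%N `|(cube_coords Q).2 0%R i1|%N.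

Lemma planarE (R : realType) n (i0 i1 : 'I_n) (D : nat -> nat -> nat -> R) r u :
  cube_index r u ->
  planar i0 i1 D (dyadic_cube r u) = D r `|u 0%R i0|%N `|u 0%R i1|%N.
Proof.
move=> ru; rewrite /planar; suff -> : cube_coords (@dyadic_cube R n r u) = (r, u) by [].
have [|_ /(dyadic_cube_inj i0)] := xgetPex (0%N, 0 : 'rV[int]_n) (P := [set p |
  cube_index p.1 p.2 /\ @dyadic_cube R n p.1 p.2 = dyadic_cube r u]).
  by exists (r, u).
by rewrite -surjective_pairing.
Qed.

Lemma cube_index_lt n r (u : 'rV[int]_n) i :
  cube_index r u -> (`|u 0%R i| < 2 ^ r)%N.
Proof.
move=> /(_ i) /andP[u0 ur].
by rewrite -ltz_nat gez0_abs// -(rmorphXn Posz) in ur *.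
Qed.

Lemma subcube_absz n r (u : 'rV[int]_n) (a : 'rV[bool]_n) i :
  cube_index r u -> `|subcube_index u a 0%R i|%N = (`|u 0%R i|.*2 + a 0%R i)%N.
Proof. by move=> /(_ i) /andP[u0 _]; rewrite mxE; lia. Qed.

Lemma subcube_cube_index n r (u : 'rV[int]_n) (a : 'rV[bool]_n) :
  cube_index r u -> cube_index r.+1 (subcube_index u a).
Proof.
move=> ru i; move: (ru i) => /andP[u0 ur]; rewrite mxE exprS.
by case: (a 0 i) => /=; lia.
Qed.

(** Each choice of the two bits at [i0] and [i1] occurs in [2 ^ (n - 2)] subcubes, so averaging over
    all subcubes reduces to averaging over four squares. *)
Lemma planar_martingale (R : realType) n (i0 i1 : 'I_n)
    (D : nat -> nat -> nat -> R) : i0 != i1 ->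
  (forall r x y, (x < 2 ^ r)%N -> (y < 2 ^ r)%N -> 0 <= D r x y) ->
  (forall r x y, (x < 2 ^ r)%N -> (y < 2 ^ r)%N ->
    \sum_(b : bool) \sum_(c : bool) D r.+1 (x.*2 + b)%N (y.*2 + c)%N =
    4 * D r x y) ->
  martingale (@planar R n i0 i1 D).
Proof.
move=> i01 D0 Dsplit; split=> [r _ [u ru <-]|r u ru].
  by rewrite planarE//; apply: D0; exact: cube_index_lt.
rewrite planarE//.
under eq_bigr => a _ do
  rewrite (planarE _ _ _ (subcube_cube_index a ru)) !(subcube_absz _ _ ru).
set x := `|u 0%R i0|%N; set y := `|u 0%R i1|%N.
have := sum_row_bool2 (fun b c => D r.+1 (x.*2 + b)%N (y.*2 + c)%N) i01.
rewrite Dsplit ?cube_index_lt// mulrCA => /(mulfI _) -> //.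
by rewrite mulKf ?expf_neq0.
Qed.

(** A cube containing [x] exists, and whichever one [get] returns, its index is forced to consist of
    the cells of [x]. *)
Lemma planar_at (R : realType) n (i0 i1 : 'I_n) (D : nat -> nat -> nat -> R)
    r (x : 'rV[R]_n) : unit_cube x ->
  martingale_at (planar i0 i1 D) r x = D r (cell r (x 0 i0)) (cell r (x 0 i1)).
Proof.
move=> x01; rewrite /martingale_at.
have [|[u ru <-] ux] := @getPex _ [set Q | dyadic_cubes r Q /\ Q x].
  exists (dyadic_cube r (\row_i (cell r (x 0 i))%:Z)); split.
    exists (\row_i (cell r (x 0 i))%:Z) => // i.
    rewrite mxE le0z_nat/= -(rmorphXn Posz) ltz_nat; exact: cell_lt.
  move=> i; rewrite mxE -PoszD addn1.
  rewrite ler_pdivrMr ?exprn_gt0// ltr_pdivlMr ?exprn_gt0// mulrC.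
  by apply: cell_itv; case/andP: (x01 i).
rewrite planarE//.
suff E i : `|u 0%R i|%N = cell r (x 0 i) by rewrite !E.
apply/esym/truncn_def; have /andP[u0 _] := ru i; have := ux i.
rewrite -(gez0_abs u0) -PoszD addn1.
by rewrite ler_pdivrMr ?exprn_gt0// ltr_pdivlMr ?exprn_gt0// mulrC.
Qed.

(** * Computability and success of the martingale *)

Lemma computes_refine_sum k m r x (F : seq nat -> nat -> nat) :
  computes k m -> computes k r -> computes k x ->
  computes k.+1 (fun w => F (behead w) (nth 0 w 0))%N ->
  computes k (fun v => refine_sum (m v) (r v) (x v) (F v)).
Proof.
move=> mP rP xP FP.
apply: (@computes_nsum k (fun v => 2 ^ m v)%N
  (fun v i => F v ((x v * 2 ^ m v + i) %/ 2 ^ r v)%N)); first by computes_auto.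
pose idx w := ((x (behead w) * 2 ^ m (behead w) + nth 0 w 0) %/
  2 ^ r (behead w))%N.
have idxP : computes k.+1 idx.
  have mP1 := computes_behead mP; have rP1 := computes_behead rP.
  have xP1 := computes_behead xP.
  by rewrite /idx; computes_auto.
(* The summation index in position [0] is replaced by the quotient [idx]; the parameters stay in
   place. *)
pose g j := if j is l.+1 then fun w => nth 0%N w l.+1 else idx.
have gP j : (j < k.+1)%N -> computes k.+1 (g j).
  by case: j => [|j] _; [exact: idxP|exact: computes_var].
apply: eq_computes (computes_comp FP gP) => w wk; congr F.
apply: (@eq_from_nth _ 0%N) => [|j].
  by rewrite !size_behead size_mkseq wk.
rewrite size_behead size_mkseq => jk.
by rewrite !nth_behead nth_mkseq.
Qed.

Lemma leq_nsum K (F : nat -> nat) k : (k < K)%N -> (F k <= nsum K F)%N.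
Proof.
by move=> kK; rewrite /nsum (bigD1 (Ordinal kK)) //= leq_addr.
Qed.

(** Numerator of the partial sum over the common denominator [4 ^ nsum K N], a multiple of every
    [4 ^ N k] with [k < K]. *)
Definition approx_num (N : nat -> nat) (T : nat -> nat -> nat -> nat)
    (K r x y : nat) : nat :=
  nsum K (fun k => test_mass (N k) (T k) r x y * 4 ^ (nsum K N - N k))%N.

Definition approx_den (N : nat -> nat) (K : nat) : nat := (4 ^ nsum K N)%N.

Lemma approx_mass_series (R : realType) N T K r x y :
  (approx_num N T K r x y)%:R / (approx_den N K)%:R =
  mass_series R N T K r x y.
Proof.
rewrite /mass_series natr_sum big_distrl /=; apply: eq_bigr => k _.
have -> : approx_den N K = (4 ^ N k * 4 ^ (nsum K N - N k))%N.
  by rewrite -expnD subnKC// leq_nsum.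
by rewrite !natrM -mulf_div divff ?mulr1 ?natrX// expf_neq0.
Qed.

Lemma test_martingale_computable (R : realType) n (i0 i1 : 'I_n) N T w :
  i0 != i1 -> light N T w ->
  computes 1 (fun v => N (nth 0 v 0))%N ->
  computes 3 (fun v => T (nth 0 v 0) (nth 0 v 1) (nth 0 v 2))%N ->
  computable_martingale (planar i0 i1 (test_martingale R N T)).
Proof.
move=> i01 Tw NP TP; split.
  apply: planar_martingale => // r x y xr yr; last first.
    exact: test_martingale_split Tw xr yr.
  have /andP[+ _] := test_martingale_between R 0 Tw xr yr.
  by rewrite /mass_series big_ord0.
(* Here [2 ^ K] is [2 ^ s] times [2 * (4 ^ r * 2 ^ w)], and [w < 2 ^ w], so the tail bound is at
   most [2 ^- s]. *)
pose K s r := (s + 2 * r + w + 1)%N.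
pose num s r x y := approx_num N T (K s r) r x y.
pose den s r := approx_den N (K s r).
exists (fun s r u => (num s r `|u 0%R i0|%N `|u 0%R i1|%N)%:R / (den s r)%:R).
split; last first.
  move=> s r u ru; rewrite planarE//.
  have /andP[lo hi] := test_martingale_between R (K s r) Tw
    (cube_index_lt i0 ru) (cube_index_lt i1 ru).
  split; first by rewrite divr_ge0.
  rewrite /= [ratr _]fmorph_div /= !ratr_nat approx_mass_series distrC.
  rewrite ger0_norm ?subr_ge0//.
  rewrite lerBlDl (le_trans hi)// lerD2l.
  rewrite ler_pdivrMr ?exprn_gt0// ler_pdivlMl ?exprn_gt0//.
  rewrite -!natrX -!natrM ler_nat /K.
  have -> : (2 ^ (s + 2 * r + w + 1) = 2 ^ s * (2 * (4 ^ r * 2 ^ w)))%N.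
    by rewrite -[4%N]/(2 ^ 2)%N -expnM -!expnD -expnS -expnD; congr expn; lia.
  by rewrite !leq_pmul2l ?expn_gt0// ltnW// ltn_expl.
have numP : computes n.+2 (fun v => num (nth 0 v 0) (nth 0 v 1)
    (nth 0 v i0.+2) (nth 0 v i1.+2))%N.
  rewrite /num /approx_num /K; computes_auto.
  apply: (@computes_refine_sum _ _ _ _ (fun v a =>
    refine_sum (N (nth 0 v 0)) (nth 0 (behead v) 1) (nth 0 (behead v) i1.+2)
      (T (nth 0 v 0) a))%N); computes_auto.
  by apply: (@computes_refine_sum _ _ _ _ (fun v b =>
    T (nth 0 (behead v) 0) (nth 0 v 0) b)%N); computes_auto.
have denP : computes n.+2 (fun v => den (nth 0 v 0) (nth 0 v 1))%N.
  by rewrite /den /approx_den /K; computes_auto.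
have [e eP] := numP; have [e' e'P] := denP; exists e, e' => s r u ru.
have uE (i : 'I_n) : nth 0%N (encode_input s r u) i.+2 = `|u 0%R i|%N.
  by rewrite /= nth_mktuple.
exists (num s r `|u 0%R i0|%N `|u 0%R i1|%N), (den s r); split=> //.
- by have := eP (encode_input s r u); rewrite !uE.
- by rewrite expn_eq0.
Qed.

(** Once [r] reaches every [N k] with [k < K], the averages are the values of the tests at the cells
    of [x]; infinitely many hits make their sum unbounded. *)
Lemma test_martingale_succeeds (R : realType) n (i0 i1 : 'I_n) N T w
    (x : 'rV[R]_n) : light N T w -> unit_cube x ->
  (forall s0, exists2 s, (s0 <= s)%N &
    (0 < T s (cell (N s) (x 0%R i0)) (cell (N s) (x 0%R i1)))%N) ->
  succeeds (planar i0 i1 (test_martingale R N T)) x.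
Proof.
move=> Tw x01 hit; pose hits k := T k (cell (N k) (x 0%R i0)) (cell (N k) (x 0%R i1)).
have unbounded m : exists K, (m <= nsum K hits)%N.
  elim: m => [|m [K mK]]; first by exists 0%N.
  have [s Ks s0] := hit K; exists s.+1; rewrite /nsum big_ord_recr /= -addn1.
  apply: leq_add s0; apply: leq_trans mK _.
  by rewrite /nsum -(subnKC Ks) big_split_ord leq_addr.
suff : (martingale_at (planar i0 i1 (test_martingale R N T)) r x)%:E
    @[r --> \oo] --> +oo%E.
  by move=> /cvg_limn_einf_sup[].
apply/cvgeryP/cvgryPge => A.
have [K AK] := unbounded (Num.bound `|A|).
exists (nsum K N) => // r /= Nr; rewrite planar_at//.
have /andP[x00 _] := x01 i0; have /andP[x10 _] := x01 i1.
have /andP[+ _] := test_martingale_between R K Tw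
  (cell_lt r (x01 i0)) (cell_lt r (x01 i1)).
apply: le_trans; apply: (@le_trans _ _ (nsum K hits)%:R).
  apply: (@le_trans _ _ (Num.bound `|A|)%:R); last by rewrite ler_nat.
  by rewrite ltW// (le_lt_trans (ler_norm _))// archi_boundP.
rewrite /mass_series natr_sum; apply: ler_sum => k _.
have Nk := leq_trans (leq_nsum N (ltn_ord k)) Nr.
by rewrite test_mass_coarse// !cell_coarse// natrM natrX mulrC mulKf// expf_neq0.
Qed.

(** The null set is the singleton of [x], whose periodization is the single vector of fractional
    parts of [x]. *)
Lemma not_random_of_tests (R : realType) n (i0 i1 : 'I_n) N T w
    (x : 'rV[R]_n) : i0 != i1 -> light N T w ->
  computes 1 (fun v => N (nth 0 v 0))%N ->
  computes 3 (fun v => T (nth 0 v 0) (nth 0 v 1) (nth 0 v 2))%N ->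
  (forall s0, exists2 s, (s0 <= s)%N &
    (0 < T s (cell (N s) (x 0%R i0 - (Num.floor (x 0%R i0))%:~R))
             (cell (N s) (x 0%R i1 - (Num.floor (x 0%R i1))%:~R)))%N) ->
  ~ computably_random x.
Proof.
move=> i01 Tw NP TP hit; apply; exists [set x]; split=> //.
exists (planar i0 i1 (test_martingale R N T)); split.
  exact: test_martingale_computable Tw NP TP.
move=> z [z01 [t _ [_ -> zE]]].
apply: (test_martingale_succeeds Tw z01) => s0.
have fracE i : z 0 i = x 0 i - (Num.floor (x 0 i))%:~R.
  have zi : z 0 i = x 0 i + (t 0 i)%:~R by rewrite -zE !mxE.
  rewrite zi; congr (_ + _); rewrite -mulrNz; congr (_%:~R).
  apply: oppr_inj; rewrite opprK; apply/esym/floor_def.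
  have := z01 i; rewrite zi rmorphD/= rmorphN/= => /andP[? ?].
  by apply/andP; split; lra.
by have [s s0s sT] := hit s0; exists s; rewrite // !fracE.
Qed.

(** * The strips covering a line *)

(* [level k] is the logarithm of [k] to the base 4, rounded down. *)
Definition level (k : nat) : nat := nsum k (fun j => (4 ^ j.+1 <= k)%N).

Lemma levelE s k : (4 ^ s <= k)%N -> (k < 4 ^ s.+1)%N -> level k = s.
Proof.
move=> sk ks; rewrite /level /nsum.
have sltk : (s <= k)%N by rewrite (leq_trans _ sk)// ltnW// ltn_expl.
rewrite -[RHS](minn_idPr sltk) -sum_ltn_ord; apply: eq_bigr => j _.
congr nat_of_bool; apply/idP/idP => [jk|js]; last first.
  by rewrite (leq_trans _ sk)// leq_exp2l.
by rewrite -(@ltn_exp2l 4)// in jk *; have := leq_ltn_trans jk ks; rewrite !ltn_exp2l.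
Qed.

Lemma level_bounds k : (0 < k)%N -> (4 ^ level k <= k < 4 ^ (level k).+1)%N.
Proof.
move=> k0; have /andP[lo hi] := trunc_log_bounds (isT : 1 < 4)%N k0.
by rewrite (levelE lo hi) lo.
Qed.

Lemma level_le k : (level k <= k.-1)%N.
Proof.
case: k => [|k]; first by rewrite /level /nsum big_ord0.
have /andP[lo _] := level_bounds (ltn0Sn k).
by rewrite -ltnS (leq_trans _ lo)// ltn_expl.
Qed.

(* A representative of [z] modulo [2 ^ N] that avoids negative numbers. *)
Definition residue (N : nat) (z : int) : nat :=
  match z with Posz n => n | Negz n => ((2 ^ N - 1) * n.+1)%N end.

Lemma residueE N z : exists t : int, (residue N z : int) = z + 2 ^+ N * t.
Proof.
case: z => n /=; first by exists 0; rewrite mulr0 addr0.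
exists n.+1; rewrite NegzE PoszM -subzn ?expn_gt0// -(rmorphXn Posz) /=; ring.
Qed.

(* The index [k] of the node [floor (2 ^ s * (i + X)) / 2 ^ s], where [X] is the
   left end of the dyadic interval of index [x] and level [N]. *)
Definition block (i : int) (N s x : nat) : nat :=
  match i with
  | Posz n => (2 * 4 ^ s + n * 2 ^ s + x %/ 2 ^ (N - s))%N
  | Negz n => (2 * 4 ^ s + x %/ 2 ^ (N - s) - n.+1 * 2 ^ s)%N
  end.

(** Large enough that [k.+1 * k.+1 <= resolution s] for every [k < 4 ^ s.+1], so that all strips of
    stage [s] are resolved by its squares. *)
Definition resolution (s : nat) : nat := (4 ^ s.+1 * 4 ^ s.+1 + 4 ^ s.+1)%N.

(* If [a] consists of the first [k * k] bits of the slope, then [lead_bits k a l]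
   consists of its first [l * l] bits, and [digit k a N l * 2 ^ level l] is the
   increment between [l] and [l + 1] in units of [2 ^- N]. *)
Definition lead_bits (k a l : nat) : nat := (a %/ 2 ^ (k * k - l * l))%N.

Definition digit (k a N l : nat) : nat :=
  ((lead_bits k a l.+1 - lead_bits k a l * 2 ^ (2 * l + 1)) *
   2 ^ (N - (l.+1 * l.+1 + level l)))%N.

(* The value at abscissa [i + X] of the line with integer slope part [q] and slope
   bits [a], in units of [2 ^- N] and modulo [2 ^ N]. *)
Definition centre (q i : int) (N k a x : nat) : nat :=
  (residue N q * x + (a * x) %/ 2 ^ (k * k) +
   2 ^ (N - k * k) * (a * residue N i) +
   nsum k (fun l => digit k a N l * (2 * 4 ^ level l + (2 ^ N - 1) * l)))%N.

(** The distance [2 ^- (k * k + s)] in units of [2 ^- N], times a constant collecting the error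
    terms of [centre_error]. *)
Definition slack (q : int) (N k s : nat) : nat :=
  ((`|q| + 6) * 2 ^ (N - (k * k + s)))%N.

(* The test [y + slack - centre <= 2 * slack] modulo [2 ^ N] counts the slopes [a]
   whose strip comes close to the square of index [(x, y)]; the factor [k < 4 ^ s.+1]
   only serves to make the subtractions in exponents exact. *)
Definition strip_at (q i : int) (N s k x y : nat) : nat :=
  ((k < 4 ^ s.+1) * nsum (2 ^ (k * k)) (fun a =>
     ((y + slack q N k s + (2 ^ N - 1) * centre q i N k a x) %% 2 ^ N <=
      2 * slack q N k s)%N))%N.

(** Each column of squares uses the node next to its own abscissa, so the number of slopes tested
    varies with the column. *)
Definition strip (q i : int) (s x y : nat) : nat :=
  strip_at q i (resolution s) s (block i (resolution s) s x) x y.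

(** * Computability and area of the strips *)

Lemma computes_residue k N z :
  computes k N -> computes k (fun v => residue (N v) z).
Proof. by move=> NP; case: z => n /=; computes_auto. Qed.

Lemma computes_block k i N s x : computes k N -> computes k s -> computes k x ->
  computes k (fun v => block i (N v) (s v) (x v)).
Proof. by move=> NP sP xP; case: i => n /=; computes_auto. Qed.

Lemma computes_resolution : computes 1 (fun v => resolution (nth 0 v 0))%N.
Proof. by rewrite /resolution; computes_auto. Qed.

Lemma computes_level : computes 1 (fun v => level (nth 0 v 0))%N.
Proof. by rewrite /level; computes_auto. Qed.

Lemma computes_strip q i :
  computes 3 (fun v => strip q i (nth 0 v 0) (nth 0 v 1) (nth 0 v 2))%N.
Proof.
have lP := computes_level; have rP := computes_resolution.
rewrite /strip /strip_at /slack /centre /digit /lead_bits.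
by repeat first [assumption |
  lazymatch goal with
  | |- computes _ (fun v => residue (@?N v) ?z) =>
      apply: (@computes_residue _ N z)
  | |- computes _ (fun v => block ?i (@?N v) (@?s v) (@?x v)) =>
      apply: (@computes_block _ i N s x)
  end | computes_step; cbv beta].
Qed.

(** Adding [z] modulo [M] permutes the residues. *)
Lemma sum_residues_le M z W : (\sum_(y < M) ((y + z) %% M <= W) <= W.+1)%N.
Proof.
case: M => [|M]; first by rewrite big_ord0.
pose h (y : 'I_M.+1) : 'I_M.+1 := Ordinal (ltn_pmod (y + z) (ltn0Sn M)).
have h_inj : injective h.
  move=> y y' /(congr1 val)/eqP /=; rewrite eqn_modDr !modn_small// => /eqP.
  exact: val_inj.
have := sum_ltn_ord M.+1 W.+1; rewrite (reindex_inj h_inj) /= => ->.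
exact: geq_minr.
Qed.

(** Each column is bounded separately: each of its [2 ^ (k * k)] slopes accepts at most
    [2 * slack + 1 <= 3 * slack] values of [y], and the factor [2 ^ (k * k)] cancels against
    [slack], whatever [k] is there. *)
Lemma strip_light q i : light resolution (strip q i) (3 * (`|q| + 6))%N.
Proof.
move=> s; set N := resolution s; set w := (3 * (`|q| + 6))%N.
suff col x : (2 ^ s * \sum_(y < 2 ^ N) strip q i s x y <= w * 2 ^ N)%N.
  rewrite big_distrr /= (_ : 4 ^ N = 2 ^ N * 2 ^ N)%N; last by rewrite -expnMn.
  apply: (@leq_trans (\sum_(x < 2 ^ N) w * 2 ^ N)%N); first exact: leq_sum.
  by rewrite sum_nat_const card_ord mulnCA.
rewrite /strip -/N; set k := block _ _ _ _; rewrite /strip_at.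
have [kK|_] := ltnP k (4 ^ s.+1)%N; last by rewrite big1 ?muln0.
have kN : (k * k + s <= N)%N.
  have : (s.+1 < 4 ^ s.+1)%N by rewrite ltn_expl.
  by rewrite /N /resolution; nia.
under eq_bigr do rewrite mul1n.
rewrite /nsum exchange_big /=.
apply: (@leq_trans (2 ^ s * (\sum_(a < 2 ^ (k * k)) (2 * slack q N k s).+1))%N).
  rewrite leq_pmul2l ?expn_gt0//; apply: leq_sum => a _.
  under eq_bigr do rewrite -addnA.
  exact: sum_residues_le.
rewrite sum_nat_const card_ord.
apply: (@leq_trans (2 ^ s * (2 ^ (k * k) * (3 * slack q N k s)))%N).
  rewrite !leq_pmul2l ?expn_gt0//.
  have : (0 < slack q N k s)%N by rewrite muln_gt0 expn_gt0 addn_gt0 orbT.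
  lia.
rewrite /slack -{2}(subnKC kN) !expnD /w; lia.
Qed.

(** * Truncated slopes, nodes and the intercept *)

Definition trunc_square (R : realType) (mu : R) (l : nat) : R :=
  (cell (l * l) mu)%:R / 2 ^+ (l * l).

(* The nodes of level [s] are the multiples of [2 ^- s] in [- 2 ^ s, 2 ^ s.+1). *)
Definition node (R : realType) (l : nat) : R :=
  (l%:R - 2 * 4 ^+ level l) / 2 ^+ level l.

(** Partial sums of the intercept [c], with [trunc_square mu l] as [mu_l] and [node R l] as
    [xi_l]. *)
Definition offset (R : realType) (mu : R) (k : nat) : R :=
  - \sum_(l < k) (trunc_square mu l.+1 - trunc_square mu l) * node R l.

Lemma pow2V_gt0 (R : realType) n : 0 < (2 ^+ n)^-1 :> R.
Proof. by rewrite invr_gt0 exprn_gt0. Qed.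

Lemma trunc_square_itv (R : realType) (mu : R) l : 0 <= mu ->
  trunc_square mu l <= mu < trunc_square mu l + (2 ^+ (l * l))^-1.
Proof.
move=> mu0; rewrite /trunc_square; have := cell_itv (l * l) mu0.
rewrite -[X in _ + X]mul1r -mulrDl natr1 mulrC.
by rewrite ler_pdivrMr ?exprn_gt0// ltr_pdivlMr ?exprn_gt0.
Qed.

Lemma trunc_square_step (R : realType) (mu : R) l : 0 <= mu ->
  `|trunc_square mu l.+1 - trunc_square mu l| <= (2 ^+ (l * l))^-1.
Proof.
move=> mu0; have := trunc_square_itv l mu0; have := trunc_square_itv l.+1 mu0.
have : (2 ^+ (l.+1 * l.+1))^-1 <= (2 ^+ (l * l))^-1 :> R.
  rewrite lef_pV2 ?posrE ?exprn_gt0// ler_weXn2l ?ler1n//; nia.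
move=> ? /andP[? ?] /andP[? ?]; rewrite ler_norml; apply/andP; split; lra.
Qed.

Lemma node_le (R : realType) l : (0 < l)%N ->
  `|node R l| <= 2 * 2 ^+ level l.
Proof.
move=> /level_bounds /andP[lo hi].
rewrite /node normrM normfV [X in _ / X]ger0_norm ?exprn_ge0//.
rewrite ler_pdivrMr ?exprn_gt0// -mulrA -expr2 -exprM mulnC exprM.
rewrite (_ : 2 ^+ 2 = 4); last by ring.
have : 4 ^+ level l <= l%:R :> R by rewrite -natrX ler_nat.
have : l%:R < 4 ^+ (level l).+1 :> R by rewrite -natrX ltr_nat.
rewrite exprS => ? ?; rewrite ler_norml; apply/andP; split; lra.
Qed.

(** The sequence [u k - 2 * e k] increases and [u k + 2 * e k] decreases; the supremum of the former
    lies between them. *)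
Lemma geometric_limit (R : realType) (u e : nat -> R) :
  (forall k, 0 <= e k) -> (forall k, 2 * e k.+1 <= e k) ->
  (forall k, `|u k.+1 - u k| <= e k) ->
  exists c, forall k, `|c - u k| <= 2 * e k.
Proof.
move=> e0 ee ue.
have lo i j : u i - 2 * e i <= u (i + j)%N - 2 * e (i + j)%N.
  elim: j => [|j IHj]; first by rewrite addn0.
  rewrite addnS; have := ue (i + j)%N; have := ee (i + j)%N.
  by rewrite ler_norml => ? /andP[? ?]; lra.
have hi i j : u (i + j)%N + 2 * e (i + j)%N <= u i + 2 * e i.
  elim: j => [|j IHj]; first by rewrite addn0.
  rewrite addnS; have := ue (i + j)%N; have := ee (i + j)%N.
  by rewrite ler_norml => ? /andP[? ?]; lra.
exists (sup (range (fun k => u k - 2 * e k))) => k.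
have ab i j : u i - 2 * e i <= u j + 2 * e j.
  by have := lo i j; have := hi j i; have := e0 (i + j)%N; rewrite addnC; lra.
have /andP[? ?] := sup_between ab k.
by rewrite ler_norml; apply/andP; split; lra.
Qed.

(** The increment at [k] is at most [2 * 2 ^+ level k / 2 ^+ (k * k)], and squares outgrow [level],
    so these bounds at least halve at each step. The shift by one keeps the index positive, as
    [node_le] requires. *)
Lemma offset_limit (R : realType) (mu : R) : 0 <= mu ->
  exists c, forall k, (0 < k)%N ->
    `|c - offset mu k| <= 2 * (2 * 2 ^+ level k / 2 ^+ (k * k)).
Proof.
move=> mu0.
have [||k|c cP] := @geometric_limit R (fun k => offset mu k.+1)
  (fun k => 2 * 2 ^+ level k.+1 / 2 ^+ (k.+1 * k.+1)).
- by move=> k; rewrite divr_ge0 ?mulr_ge0 ?exprn_ge0.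
- move=> k; rewrite mulrA ler_pdivrMr ?exprn_gt0// mulrAC ler_pdivlMr ?exprn_gt0//.
  rewrite -!exprS -!exprD ler_weXn2l ?ler1n//.
  by have := level_le k.+2; rewrite /=; nia.
- rewrite /offset big_ord_recr /= opprD addrAC subrr add0r normrN normrM mulrC.
  by apply: ler_pM => //; [exact: node_le|exact: trunc_square_step].
- by exists c => -[//|k] _; exact: cP.
Qed.

Lemma lead_bits_cell (R : realType) (mu : R) k l : 0 <= mu -> (l <= k)%N ->
  lead_bits k (cell (k * k) mu) l = cell (l * l) mu.
Proof. by move=> mu0 lk; apply: cell_coarse => //; exact: leq_mul. Qed.

(** Slope increments are multiples of [2 ^- (l.+1 * l.+1)] and nodes are multiples of
    [2 ^- level l]; for [l < k] the two exponents together stay below [N]. *)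
Lemma offset_int (R : realType) (mu : R) k N : 0 <= mu -> (k * k + k <= N)%N ->
  2 ^+ N * offset mu k =
  (\sum_(l < k) (digit k (cell (k * k) mu) N l)%:Z *
     (2 * 4 ^+ level l - l%:Z))%:~R.
Proof.
move=> mu0 kN; rewrite /offset mulrN mulr_sumr rmorph_sum -sumrN.
apply: eq_bigr => -[l lk] _ /=.
rewrite /digit !lead_bits_cell ?(ltnW lk)//.
have le : (cell (l * l) mu * 2 ^ (2 * l + 1) <= cell (l.+1 * l.+1) mu)%N.
  rewrite -(@cell_coarse _ (l * l) (l.+1 * l.+1)%N) ?leq_mul//.
  rewrite (_ : l.+1 * l.+1 - l * l = 2 * l + 1)%N ?leq_divM//; lia.
have lN : (l.+1 * l.+1 + level l <= N)%N.
  by have := level_le l; nia.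
have E : (2 * 4 ^+ level l - l%:Z)%:~R = 2 * 4 ^+ level l - l%:R :> R.
  by rewrite intrB intrM rmorphXn.
rewrite intrM E -!pmulrn.
rewrite natrM natrB// natrM !natrX /node /trunc_square.
rewrite -{1}(subnK lN) !exprD (_ : l.+1 * l.+1 = l * l + (2 * l + 1))%N; last lia.
rewrite !exprD.
by field; rewrite ?andbT ?expf_neq0.
Qed.

(** * Points of the line meet their strips *)

Lemma modn_le_congr (n r M : nat) (t : int) :
  n%:Z = r%:Z + M%:Z * t -> (n %% M <= r)%N.
Proof.
move=> nE; suff -> : (n %% M = r %% M)%N by exact: leq_mod.
by apply/eqP; rewrite -eqz_nat -!modz_nat nE addrC mulrC modzMDl.
Qed.

Lemma leq_resolution s k : (k < 4 ^ s.+1)%N -> (k.+1 * k.+1 <= resolution s)%N.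
Proof. by rewrite /resolution; nia. Qed.

(** The bound on [i] makes the truncated subtraction in [block] exact for negative [i]. *)
Lemma blockE (R : realType) (i : int) s (x : R) : 0 <= x < 1 ->
  (`|i| < 2 ^ s)%N ->
  (block i (resolution s) s (cell (resolution s) x))%:Z =
    2 * 4 ^+ s + i * 2 ^+ s + (cell s x)%:Z.
Proof.
move=> x01 i2; have /andP[x0 _] := x01.
have sN : (s <= resolution s)%N.
  by have := ltn_expl s.+1 (isT : 1 < 4)%N; rewrite /resolution; nia.
have -> : 2 * 4 ^+ s + i * 2 ^+ s + (cell s x)%:Z =
    (2 * 4 ^ s)%N%:Z + i * (2 ^ s)%N%:Z + (cell s x)%:Z.
  by rewrite PoszM -!(rmorphXn Posz).
case: i i2 => m mi; rewrite /block /= cell_coarse//.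
have ms : (m.+1 * 2 ^ s <= 2 * 4 ^ s)%N.
  rewrite -[4%N]/(2 * 2)%N expnMn mulnA leq_pmul2r ?expn_gt0//.
  by move: mi; rewrite /= ; lia.
rewrite -subzn; last exact: leq_trans (leq_addr _ _).
by rewrite NegzE PoszD PoszM; lia.
Qed.

(** This is the range of level [s], so that [levelE] applies to the chosen node. *)
Lemma block_bounds (R : realType) (i : int) s (x : R) : 0 <= x < 1 ->
  (`|i| < 2 ^ s)%N ->
  let k := block i (resolution s) s (cell (resolution s) x) in
  (4 ^ s <= k < 4 ^ s.+1)%N.
Proof.
move=> x01 i2 /=; set k := block _ _ _ _.
have kE := blockE x01 i2; rewrite -/k in kE.
have h := cell_lt s x01.
have E4 : (4 ^ s = 2 ^ s * 2 ^ s)%N by rewrite -expnMn.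
have kE' : k%:Z = 2 * (2 ^ s * 2 ^ s)%N%:Z + i * (2 ^ s)%N%:Z + (cell s x)%:Z.
  by rewrite kE -E4 -!(rmorphXn Posz).
rewrite expnS E4; move: (2 ^ s)%N i2 h kE' => p i2 h kE'.
clearbody k; clear -i2 h kE'; case: i i2 kE' => m /= i2 kE'; apply/andP; split; nia.
Qed.

(** The shifts by [2 * 4 ^+ s] in [block] and [node] cancel, leaving the error of truncating [x] to
    [s] bits. *)
Lemma node_block (R : realType) (i : int) s (x : R) : 0 <= x < 1 ->
  (`|i| < 2 ^ s)%N ->
  `|x + i%:~R - node R (block i (resolution s) s (cell (resolution s) x))| <=
  (2 ^+ s)^-1.
Proof.
move=> x01 i2; have /andP[lo hi] := block_bounds x01 i2.
rewrite /node (levelE lo hi); set k := block _ _ _ _.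
have -> : k%:R = 2 * 4 ^+ s + i%:~R * 2 ^+ s + (cell s x)%:R :> R.
  have := congr1 (intr : int -> R) (blockE x01 i2).
  by rewrite !intrD !intrM !rmorphXn.
have -> : x + i%:~R - (2 * 4 ^+ s + i%:~R * 2 ^+ s + (cell s x)%:R -
    2 * 4 ^+ s) / 2 ^+ s = (2 ^+ s * x - (cell s x)%:R) / 2 ^+ s.
  by field; rewrite expf_neq0.
have /andP[x0 _] := x01; have /andP[] := cell_itv s x0.
rewrite -natr1 => cl ch; rewrite ger0_norm; last first.
  by rewrite divr_ge0 ?exprn_ge0// subr_ge0.
by rewrite ler_pdivrMr ?exprn_gt0// mulVf ?expf_neq0//; lra.
Qed.

(** Modulo [2 ^ N] the residues stand for [q] and [i], and [(2 ^ N - 1) * l] stands for [- l]. *)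
Lemma centreE (q i : int) N k a x : exists t : int,
  (centre q i N k a x)%:Z = q * x%:Z + ((a * x) %/ 2 ^ (k * k))%N%:Z +
    (2 ^ (N - k * k))%N%:Z * (a%:Z * i) +
    \sum_(l < k) (digit k a N l)%:Z * (2 * 4 ^+ level l - l%:Z) + 2 ^+ N * t.
Proof.
have [tq qE] := residueE N q; have [ti iE] := residueE N i.
exists (tq * x%:Z + (2 ^ (N - k * k))%N%:Z * (a%:Z * ti) +
  \sum_(l < k) (digit k a N l)%:Z * l%:Z).
have sumE : (nsum k (fun l => digit k a N l *
      (2 * 4 ^ level l + (2 ^ N - 1) * l)))%N%:Z =
    \sum_(l < k) (digit k a N l)%:Z * (2 * 4 ^+ level l - l%:Z) +
    2 ^+ N * \sum_(l < k) (digit k a N l)%:Z * l%:Z.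
  rewrite mulr_sumr -big_split /nsum (big_morph Posz PoszD (erefl _)) /=.
  apply: eq_bigr => l _.
  move: (digit k a N l) => D.
  by rewrite PoszM PoszD !PoszM -subzn ?expn_gt0// -!(rmorphXn Posz) /=; ring.
by rewrite /centre !PoszD !PoszM sumE qE iE; ring.
Qed.

Lemma normM_le (R : realType) (a b A B C : R) :
  `|a| <= A -> `|b| <= B -> A * B <= C -> `|a * b| <= C.
Proof. by move=> aA bB; apply: le_trans; rewrite normrM ler_pM. Qed.

(** Expanding [(q + mu) * (x + i) + c - j] in units of [2 ^- N] leaves the centre, the whole turns
    [2 ^+ N * (q * i - j)] and small errors. *)
Lemma centre_error (R : realType) (q i j : int) (mu c x y : R) s :
  0 <= mu < 1 ->
  (forall k, (0 < k)%N ->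
    `|c - offset mu k| <= 2 * (2 * 2 ^+ level k / 2 ^+ (k * k))) ->
  0 <= x < 1 -> 0 <= y < 1 ->
  y + j%:~R = (q%:~R + mu) * (x + i%:~R) + c ->
  (`|i| < 2 ^ s)%N ->
  let N := resolution s in
  let k := block i N s (cell N x) in
  let a := cell (k * k) mu in
  `|(cell N y)%:Z - (q * (cell N x)%:Z + ((a * cell N x) %/ 2 ^ (k * k))%N%:Z +
      (2 ^ (N - k * k))%N%:Z * (a%:Z * i) +
      \sum_(l < k) (digit k a N l)%:Z * (2 * 4 ^+ level l - l%:Z))
    - 2 ^+ N * (q * i - j)| <= (slack q N k s)%:Z.
Proof.
move=> mu01 cP x01 y01 yE i2 /=.
set N := resolution s; set k := block i N s (cell N x); set a := cell (k * k) mu.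
have /andP[lok hik] := block_bounds x01 i2; rewrite -/N -/k in lok hik.
have kk : (k.+1 * k.+1 <= N)%N := leq_resolution hik.
have sk : (s < k)%N by apply: leq_trans lok; rewrite ltn_expl.
have k0 : (0 < k)%N by exact: leq_ltn_trans sk.
have xi := node_block x01 i2; rewrite -/N -/k in xi.
have /andP[x0 x1] := x01; have /andP[y0 y1] := y01; have /andP[mu0 mu1] := mu01.
have kkN : (k * k + k <= N)%N by apply: leq_trans kk; rewrite mulSn mulnS; lia.
have skN : (k * k + s <= N)%N by apply: leq_trans kkN; rewrite leq_add2l ltnW.
have kkN' : (k * k <= N)%N by apply: leq_trans kkN; rewrite leq_addr.
(* Since [s < k] and [level k.+1 <= k], the [2 * k + 1] bits gained between consecutive squares
   absorb the factor [2 ^+ s] in [t5] and the factor [4 * 2 ^+ level k.+1] in [t6]. *)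
have ssk : (s + (k * k + s) <= k.+1 * k.+1)%N by rewrite mulSn mulnS; lia.
have lsk : ((level k.+1).+2 + (k * k + s) <= k.+1 * k.+1)%N.
  by have := level_le k.+1; rewrite mulSn mulnS; lia.
pose M : R := 2 ^+ N; pose P : R := 2 ^+ (k * k).
pose B : R := 2 ^+ (N - (k * k + s)).
have M0 : 0 < M by rewrite exprn_gt0.
have P0 : 0 < P by rewrite exprn_gt0.
have ME : M = B * P * 2 ^+ s by rewrite /M /B /P -mulrA -!exprD subnK.
have B1 : 1 <= B by rewrite exprn_ege1// ler1n.
rewrite -(ler_int R) intr_norm /slack.
set S := \sum_(l < k) _.
have SE : M * offset mu k = S%:~R.
  by rewrite /S -offset_int.
rewrite !(intrB, intrD, intrM) rmorphXn /= -!pmulrn !natrM natrD !natrX.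
rewrite natr_absz -/M -/B -SE.
set X : R := (cell N x)%:R; set Y : R := (cell N y)%:R.
have /andP[Xlo Xhi] := cell_itv N x0; rewrite -/M -/X -natr1 in Xlo Xhi.
have /andP[Ylo Yhi] := cell_itv N y0; rewrite -/M -/Y -natr1 in Ylo Yhi.
set F : R := (_ %/ _)%N%:R.
have Flo : F <= a%:R * X / P.
  by rewrite ler_pdivlMr// /F /X /P -natrX -!natrM ler_nat leq_divM.
have Fhi : a%:R * X / P < F + 1.
  rewrite ltr_pdivrMr// /F /X /P natr1 -natrX -!natrM ltr_nat.
  by rewrite ltn_ceil ?expn_gt0.
have NkE : 2 ^+ (N - k * k) = M / P :> R.
  by rewrite /M -[in RHS](@subnK (k * k) N) ?exprD ?mulfK ?expf_neq0.
rewrite NkE.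
(* The slope splits into its first [k * k] bits, the increment [d] paired with node [k], and the
   tail [rho]; the intercept is split at the same place. *)
pose d := trunc_square mu k.+1 - trunc_square mu k.
pose rho := mu - trunc_square mu k.+1.
have muE : mu = a%:R / P + d + rho.
  by rewrite /rho /d /trunc_square -/a -/P; ring.
have offE : offset mu k.+1 = offset mu k - d * node R k.
  by rewrite /offset big_ord_recr /= opprD.
(* In turn: rounding of [x] times [q] and times [a / P], the floor in the quotient, the distance to
   the node times [d], the tail of the slope, the tail of the intercept. *)
pose t1 := q%:~R * (M * x - X).
pose t2 := a%:R / P * (M * x - X).
pose t3 := a%:R * X / P - F.
pose t4 := M * (d * (x + i%:~R - node R k)).
pose t5 := M * (rho * (x + i%:~R)).
pose t6 := M * (c - offset mu k.+1).
have -> : Y - (q%:~R * X + F + M / P * (a%:R * i%:~R) + M * offset mu k) -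
    M * (q%:~R * i%:~R - j%:~R) =
    t1 + t2 + t3 + t4 + t5 + t6 - (M * y - Y).
  rewrite /t1 /t2 /t3 /t4 /t5 /t6 offE.
  have -> : y = (q%:~R + (a%:R / P + d + rho)) * (x + i%:~R) + c - j%:~R.
    by rewrite -muE -yE addrK.
  by ring.
have T1 : `|t1| <= `|q%:~R|.
  apply: (@normM_le _ _ _ `|q%:~R| 1); rewrite ?mulr1 //.
  by rewrite ler_norml; apply/andP; split; lra.
have T2 : `|t2| <= 1.
  apply: (@normM_le _ _ _ 1 1); rewrite ?mulr1 //.
    rewrite ger0_norm ?divr_ge0 ?(ltW P0)// ler_pdivrMr// mul1r /P -natrX ltW//.
    by rewrite ltr_nat cell_lt.
  by rewrite ler_norml; apply/andP; split; lra.
have T3 : `|t3| <= 1 by rewrite ler_norml /t3; apply/andP; split; lra.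
have MB : M / (P * 2 ^+ s) = B.
  by rewrite ME -(mulrA B) mulfK// mulf_neq0 ?expf_neq0.
have scale e : `|e| <= (P * 2 ^+ s)^-1 -> `|M * e| <= B.
  move=> eB; apply: (@normM_le _ _ _ M (P * 2 ^+ s)^-1) => //; last by rewrite MB.
  by rewrite ger0_norm// ltW.
have T4 : `|t4| <= B.
  apply: scale; apply: (normM_le (trunc_square_step k mu0) xi).
  by rewrite invfM.
have T5 : `|t5| <= B.
  apply: scale.
  apply: (@normM_le _ _ _ (2 ^+ (k.+1 * k.+1))^-1 (2 ^+ s)).
  - have := trunc_square_itv k.+1 mu0; rewrite ler_norml /rho => /andP[? ?].
    by have := pow2V_gt0 R (k.+1 * k.+1); move=> ?; apply/andP; split; lra.
  - apply: (le_trans (ler_normD _ _)); rewrite (ger0_norm x0).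
    have : (`|i|%N.+1)%:R <= 2 ^+ s :> R by rewrite -natrX ler_nat.
    by rewrite -natr1 natr_absz intr_norm; lra.
  - rewrite mulrC ler_pdivrMr ?exprn_gt0// mulrC ler_pdivlMr.
      by rewrite -!exprD ler_weXn2l ?ler1n.
    by rewrite mulr_gt0 ?exprn_gt0.
have T6 : `|t6| <= B.
  apply: scale; apply: le_trans (cP k.+1 isT) _.
  rewrite mulrA -!exprS ler_pdivrMr ?exprn_gt0// mulrC ler_pdivlMr.
    by rewrite -!exprD ler_weXn2l ?ler1n.
  by rewrite mulr_gt0 ?exprn_gt0.
have qB : `|q%:~R| <= `|q%:~R| * B :> R by rewrite ler_peMr.
(* The term [t1] costs [|q|] times [B]; [t2], [t3] and the rounding of [y] cost at most [1 <= B]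
   each, and [t4], [t5], [t6] at most [B] each: hence the constant [|q| + 6]. *)
rewrite intr_norm mulrDl.
move: T1 T2 T3 T4 T5 T6; rewrite !ler_norml.
move=> /andP[? ?] /andP[? ?] /andP[? ?] /andP[? ?] /andP[? ?] /andP[? ?].
by apply/andP; split; lra.
Qed.

(** The test fires at the slope [a] made of the true first [k * k] bits of [mu], as multiples of
    [2 ^ N] vanish in the residue. *)
Lemma strip_hit (R : realType) (q i j : int) (mu c x y : R) s :
  0 <= mu < 1 ->
  (forall k, (0 < k)%N ->
    `|c - offset mu k| <= 2 * (2 * 2 ^+ level k / 2 ^+ (k * k))) ->
  0 <= x < 1 -> 0 <= y < 1 ->
  y + j%:~R = (q%:~R + mu) * (x + i%:~R) + c ->
  (`|i| < 2 ^ s)%N ->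
  (0 < strip q i s (cell (resolution s) x) (cell (resolution s) y))%N.
Proof.
move=> mu01 cP x01 y01 yE i2; have := centre_error mu01 cP x01 y01 yE i2.
have /andP[_ hik] := block_bounds x01 i2; rewrite /= in hik *.
rewrite /strip /strip_at.
set N := resolution s; set k := block _ _ _ _; set a := cell (k * k) mu.
set X := cell N x; set Y := cell N y; set W := slack q N k s.
rewrite hik mul1n => eW.
have aP : (a < 2 ^ (k * k))%N by exact: cell_lt.
apply: leq_trans (leq_nsum _ aP); rewrite lt0b.
have [t tE] := centreE q i N k a X; move: tE eW.
set e := q * X%:Z + _ + _ + _; set z := q * i - j => tE.
rewrite ler_norml => /andP[lo hi].
(* The signed error lies between [- W] and [W]; shifted by [W] it is a natural number at most
   [2 * W]. *)
have [r rE] : exists r : nat, r%:Z = Y%:Z - e - 2 ^+ N * z + W%:Z.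
  by exists `|(Y%:Z - e - 2 ^+ N * z + W%:Z)%R|%N; rewrite gez0_abs//; lia.
apply: (@leq_trans r); last by lia.
apply: (@modn_le_congr _ _ _ (z + e - t + 2 ^+ N * t)).
rewrite rE !PoszD PoszM tE -subzn ?expn_gt0// -!(rmorphXn Posz) /=; ring.
Qed.

(** * Choice of the line *)

Lemma frac_itv (R : realType) (t : R) : 0 <= t - (Num.floor t)%:~R < 1.
Proof.
have /andP[lo hi] := floor_itv t; rewrite rmorphD/= in hi.
by apply/andP; split; lra.
Qed.

Theorem theorem14 (R : realType) (n : nat) (hn : (2 <= n)%N)
    (v : 'rV[R]_n) (hv : v != 0) :
  exists p : 'rV[R]_n, forall x : 'rV[R]_n, line p v x -> ~ computably_random x.
Proof.
have [i0 vi0] : exists i, v 0 i != 0.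
  apply/existsP; apply: contraNT hv; rewrite negb_exists => /forallP v0.
  by apply/eqP/rowP => i; rewrite mxE; apply/eqP; rewrite -[_ == _]negbK.
have [i1 i01] : exists i1, i0 != i1.
  have [->|i0n] := eqVneq i0 (Ordinal (ltnW hn)); first by exists (Ordinal hn).
  by exists (Ordinal (ltnW hn)).
(* Slope of the projection of the line to the coordinates [i0] and [i1]. *)
pose m := v 0 i1 / v 0 i0; pose q := Num.floor m; pose mu := m - q%:~R.
have mu01 : 0 <= mu < 1 := frac_itv m.
have /andP[mu0 _] := mu01.
have [c cP] := offset_limit mu0.
(* This base point projects to [(0, c)], so the projected line is the graph of [m * x + c]. *)
exists (\row_j (if j == i1 then c else 0)) => _ [t _ <-].
set x := _ + _.
have x0E : x 0 i0 = t * v 0 i0 by rewrite !mxE (negbTE i01) add0r.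
have x1E : x 0 i1 = m * x 0 i0 + c.
  by rewrite x0E !mxE eqxx /m; field.
pose i := Num.floor (x 0 i0); pose j := Num.floor (x 0 i1).
apply: (not_random_of_tests i01 (strip_light q i) computes_resolution
  (computes_strip q i)) => s0.
(* Adding the absolute value of [i] ensures that it is below [2 ^ s], so that the nodes of level [s]
   reach the abscissa. *)
exists (s0 + `|i|)%N; first exact: leq_addr.
apply: (strip_hit (j := j) mu01 cP (frac_itv _) (frac_itv _)).
  by rewrite !subrK x1E /mu; ring.
by rewrite (leq_trans (ltn_expl `|i| (isT : 1 < 2)%N))// leq_exp2l// leq_addl.
Qed.
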